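(* For every odd positive integer $k$ and every $x\in[0,1]$, $$\left[x(1-x)\right]^{\frac{k}{2}} = \frac{\pi\,(k!!)^2}{4^{k+1}}\sum_{n\geq 0}\frac{(4n+1)\left[\frac{1}{4^n}\binom{2n}{n}\right]^2}{(n+1)_{\frac{k+1}{2}}\cdot \left(\frac{1}{2}-n\right)_{\frac{k+1}{2}}}\,P_{2n}(2x-1),$$ where the series converges pointwise on $[0,1]$.
   Context: $P_m$ denotes the $m$-th Legendre polynomial on $[-1,1]$, normalized by $P_m(1)=1$. $(a)_j=a(a+1)\cdots(a+j-1)$ denotes the rising Pochhammer symbol. $k!!=k(k-2)\cdots 3\cdot 1$ is the double factorial of the odd integer $k$. *)

(* Defs.v *)
From mathcomp Require Import all_boot all_order all_algebra.
From mathcomp Require Import all_classical all_reals all_analysis.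

Set Implicit Arguments.
Unset Strict Implicit.
Unset Printing Implicit Defensive.

Import Order.TTheory GRing.Theory Num.Theory.
Import numFieldNormedType.Exports.

Local Open Scope ring_scope.

(* Rodrigues' formula; the normalization P_m(1) = 1 is [legendre1] below. *)
Definition legendre (R : fieldType) (m : nat) : {poly R} :=
  (2 ^+ m * m`!%:R)^-1 *: (('X^2 - 1) ^+ m)^`(m).

Definition pochhammer (R : pzRingType) (a : R) (j : nat) : R :=
  \prod_(i < j) (a + i%:R).

(* For even k the last factor is 2 (and 0!! = 1). *)
Fixpoint double_fact (k : nat) : nat :=
  if k is k'.+2 then (k * double_fact k')%N else 1%N.

Lemma horner_derivn_XsubC_exp (R : comNzRingType) (a : R) (m : nat)
    (q : {poly R}) :
  ((('X - a%:P) ^+ m * q)^`(m)).[a] = m`!%:R * q.[a].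
Proof.
elim: m q => [|m IHm] q; first by rewrite expr0 !mul1r derivn0.
rewrite derivSn derivM deriv_exp derivXsubC mul1r /=.
have -> : ('X - a%:P) ^+ m *+ m.+1 * q + ('X - a%:P) ^+ m.+1 * q^`()
        = ('X - a%:P) ^+ m * (q *+ m.+1 + ('X - a%:P) * q^`()).
  by rewrite mulrDr mulrnAl mulrnAr exprSr mulrA.
rewrite IHm hornerD hornerMn hornerM hornerXsubC subrr mul0r addr0.
by rewrite mulrnAr -mulrnAl -mulrnA mulnC factS.
Qed.

Lemma legendre1 (R : numFieldType) (m : nat) : (legendre R m).[1] = 1.
Proof.
rewrite /legendre hornerZ.
have -> : ('X^2 - 1 : {poly R}) = ('X - 1%:P) * ('X + 1%:P).
  by rewrite -subr_sqr polyC1 expr1n.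
rewrite exprMn horner_derivn_XsubC_exp horner_exp hornerD hornerX hornerC.
by rewrite -(natrD R 1 1) [X in _ * X]mulrC mulVf // mulf_neq0 ?expf_neq0 //
  pnatr_eq0 -?lt0n ?fact_gt0.
Qed.

(* Main.v *)
(** Put [t = 2 x - 1], so that [x (1 - x) = (1 - t^2) / 4].

    For [k = 1], expand [sqrt (1 - y) = \sum_j b_j y^j] at [y = t^2] and insert
    the expansion of [t^(2j)] in even Legendre polynomials, whose coefficients
    are nonnegative and sum to 1.  Since [|P_m| <= 1] on [[-1, 1]] and the tails
    of [\sum_j |b_j|] telescope, the two summations can be exchanged.  The
    resulting coefficients satisfy a first-order recurrence in [n] by creative
    telescoping, starting from [\sum_j b_j / (2j + 1) = pi / 4], the area of a
    quarter disc.

    Passing from [k] to [k + 2] is multiplication by [1 - t^2], which acts on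
    Legendre coefficients through the three-term recurrence for [t^2 P_(2n)];
    the boundary term of the partial sums vanishes in the limit. *)

Require Import Defs.
From mathcomp Require Import all_boot all_order all_algebra.
From mathcomp Require Import all_classical all_reals all_analysis.
From mathcomp Require Import ring lra.

Set Implicit Arguments.
Unset Strict Implicit.
Unset Printing Implicit Defensive.

Import Order.TTheory GRing.Theory Num.Theory.
Import numFieldNormedType.Exports.

Local Open Scope classical_set_scope.
Local Open Scope ring_scope.

(** * Recurrence and differential equation of the Legendre polynomials, from Rodrigues' formula *)

Lemma derivn_mulX (R : comNzRingType) (p : {poly R}) (m : nat) :
  ('X * p)^`(m) = 'X * p^`(m) + m%:R * p^`(m.-1).
Proof.
elim: m => [|m IHm]; first by rewrite !derivn0 mul0r addr0.
rewrite derivnS IHm derivD !derivM derivX -polyC_natr derivC mul0r add0r mul1r.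
rewrite polyC_natr -derivnS.
case: m {IHm} => [|m]; first by rewrite /= mul0r; ring.
by rewrite -derivnS /= -[m.+2]addn1 natrD; ring.
Qed.

Lemma deriv_X2B1_exp (R : comNzRingType) (m : nat) :
  (('X^2 - 1 : {poly R}) ^+ m.+1)^`() = 'X * (('X^2 - 1) ^+ m *+ (2 * m.+1)).
Proof.
rewrite deriv_exp derivB derivXn -polyC1 derivC subr0 /= expr1.
by ring.
Qed.

Lemma deriv2_X2B1_exp (R : comNzRingType) (m : nat) :
  (('X^2 - 1 : {poly R}) ^+ m.+2)^`()^`() =
    ('X^2 - 1) ^+ m.+1 *+ (2 * m.+2 * (2 * m.+1).+1)
    + ('X^2 - 1) ^+ m *+ (4 * (m.+1 * m.+2)).
Proof.
rewrite deriv_X2B1_exp derivM derivX mul1r derivMn.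
rewrite deriv_X2B1_exp exprS; ring.
Qed.

Section LegendrePoly.
Variable R : numFieldType.
Local Notation P := (legendre R).

Lemma polynat_neq0 n : (n.+1%:R : {poly R}) != 0.
Proof. by rewrite -polyC_natr polyC_eq0 pnatr_eq0. Qed.

Lemma rodrigues_factor_neq0 m : (2 ^+ m * m`!%:R : {poly R}) != 0.
Proof.
rewrite mulf_neq0 ?expf_neq0 ?polynat_neq0 //.
by rewrite -[m`!]prednK ?fact_gt0 ?polynat_neq0.
Qed.

Lemma rodrigues m : (2 ^+ m * m`!%:R) * P m = (('X^2 - 1) ^+ m)^`(m).
Proof.
rewrite /legendre -mul_polyC mulrA.
rewrite (_ : 2 ^+ m * m`!%:R = (2 ^+ m * m`!%:R)%:P); last first.
  by rewrite rmorphM rmorphXn /= !polyC_natr.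
have c0 : 2 ^+ m * m`!%:R != 0 :> R.
  by rewrite mulf_neq0 ?expf_neq0 // pnatr_eq0 -?lt0n ?fact_gt0.
by rewrite -polyCM mulfV ?mul1r.
Qed.

Lemma legendre_0 : P 0 = 1.
Proof. by rewrite /legendre !expr0 mul1r invr1 scale1r derivn0. Qed.

Lemma legendre_1 : P 1 = 'X.
Proof.
apply: (mulfI (rodrigues_factor_neq0 1)); rewrite rodrigues derivn1.
by rewrite deriv_X2B1_exp factS fact0; ring.
Qed.

(** The derivative of order [m.+2] of [('X^2 - 1) ^+ m.+2] is computed twice, peeling off first one
    derivative ([f1]) and then two ([f2]). Both results involve the same [m]-th derivative [E],
    which is eliminated. *)
Lemma legendre_rec m :
  m.+2%:R * P m.+2 = (2 * m.+1).+1%:R * ('X * P m.+1) - m.+1%:R * P m.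
Proof.
set c : {poly R} := 2 ^+ m * m`!%:R.
have c0 : c != 0 by exact: rodrigues_factor_neq0.
have e1 : (('X^2 - 1) ^+ m.+1)^`(m.+1) = (2 * m.+1)%:R * c * P m.+1.
  by rewrite -rodrigues exprS factS /c; ring.
have e2 : (('X^2 - 1) ^+ m.+2)^`(m.+2)
    = (2 * m.+2)%:R * (2 * m.+1)%:R * c * P m.+2.
  by rewrite -rodrigues 2!exprS 2!factS /c; ring.
have := e2; rewrite derivSn deriv_X2B1_exp mulrnAr derivnMn derivn_mulX succnK e1.
have := e2; rewrite 2!derivSn.
rewrite deriv2_X2B1_exp derivnD !derivnMn -rodrigues -/c.
set E := (_ ^+ m.+1)^`(m) => f2 f1.
set A := (2 * m.+2)%:R * _ * c * P m.+2 in f1 f2.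
have K0 : 4 * m.+1%:R * m.+2%:R * c != 0 by rewrite mulf_neq0 // !mulf_neq0 ?polynat_neq0.
apply: (mulfI K0).
(* The weights [2m+3] for [f1] and [m+1] for [f2] make the two [E] terms cancel. *)
transitivity ((2 * m.+1).+1%:R * A - m.+1%:R * A); first by rewrite /A; ring.
by rewrite -[in X in X - _]f1 -f2; ring.
Qed.

Lemma legendre_rec_mulX m :
  (2 * m.+1).+1%:R * ('X * P m.+1) = m.+2%:R * P m.+2 + m.+1%:R * P m.
Proof. by rewrite legendre_rec subrK. Qed.

(** The power [u] of [X^2 - 1] satisfies [(X^2 - 1) u' = 2 (m+1) X u]. Differentiating this [m+2]
    times by Leibniz gives an equation for [u^(m+1)], which is a constant multiple of [P_(m+1)]. *)
Lemma legendre_ode m :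
  ('X^2 - 1) * (P m.+1)^`()^`() + 2 * ('X * (P m.+1)^`())
    = (m.+1 * m.+2)%:R * P m.+1.
Proof.
pose u : {poly R} := ('X^2 - 1) ^+ m.+1.
set c : {poly R} := 2 ^+ m.+1 * m.+1`!%:R.
have cE : c = ((2 ^ m.+1 * m.+1`!)%:R)%:P by rewrite polyC_natr natrM natrX.
have U0 : u^`(m.+1) = c * P m.+1 by rewrite rodrigues.
have U1 : u^`(m.+2) = c * (P m.+1)^`().
  by rewrite derivnS U0 cE derivM derivC mul0r add0r.
have U2 : u^`(m.+3) = c * (P m.+1)^`()^`().
  by rewrite derivnS U1 cE derivM derivC mul0r add0r.
have : 'X * ('X * u^`()) - u^`() = ('X * u) *+ (2 * m.+1).
  by rewrite deriv_X2B1_exp /u [_ ^+ m.+1]exprS; ring.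
move=> /(congr1 (derivn m.+2)).
rewrite derivnB derivnMn !derivn_mulX !succnK -!derivSn U0 U1 U2 => /eqP.
rewrite -subr_eq0 => /eqP f; apply: (mulfI (rodrigues_factor_neq0 m.+1)).
apply/eqP; rewrite -subr_eq0 -/c -[X in _ == X]f; apply/eqP; ring.
Qed.

Lemma horner_legendreN m x : (P m).[- x] = (-1) ^+ m * (P m).[x].
Proof.
elim/ltn_ind: m => -[|[|m]] IHm.
- by rewrite legendre_0 !hornerC mul1r.
- by rewrite legendre_1 !hornerX expr1 mulN1r.
have m0 : m.+2%:R != 0 :> R by rewrite pnatr_eq0.
apply: (mulfI m0); rewrite mulrCA.
have h y : m.+2%:R * (P m.+2).[y]
    = (2 * m.+1).+1%:R * (y * (P m.+1).[y]) - m.+1%:R * (P m).[y].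
  have /(congr1 (horner^~ y)) := legendre_rec m.
  by rewrite -!polyC_natr !hornerE.
by rewrite !h !IHm // !exprS; ring.
Qed.
End LegendrePoly.

(** * The bound [|P_m| <= 1] on [[-1, 1]] *)

Lemma poly_MVT (R : realType) (p : {poly R}) (a b : R) : a <= b ->
  exists2 c, a <= c <= b & p.[b] - p.[a] = p^`().[c] * (b - a).
Proof.
move=> ab.
have [|c cab E] := @MVT_segment R (horner p) (horner p^`()) a b ab.
  exact/continuous_subspaceT/continuous_horner.
by exists c => //; rewrite in_itv in cab.
Qed.

Section LegendreBound.
Variable R : realType.
Local Notation P := (legendre R).

(* By the Legendre equation, [m(m+1) P_m^2 + (1 - X^2) P_m'^2] has derivative
   [2 X P_m'^2], hence is maximal at 1 on [[0, 1]]. *)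
Lemma legendre_le1_ge0 m (t : R) : 0 <= t <= 1 -> `|(P m).[t]| <= 1.
Proof.
case: m => [|m] /andP[t0 t1]; first by rewrite legendre_0 hornerC normr1.
pose e : R := (m.+1 * m.+2)%:R.
have e0 : 0 < e by rewrite ltr0n.
pose V : {poly R} := e%:P * P m.+1 ^+ 2 + (1 - 'X^2) * (P m.+1)^`() ^+ 2.
have VE : V^`() = 2 * 'X * (P m.+1)^`() ^+ 2.
  rewrite /V derivD !derivM derivC mul0r add0r derivB derivXn -polyC1 derivC.
  rewrite /e polyC_natr.
  set Q := (P m.+1)^`()^`().
  transitivity (2 * (P m.+1)^`() * ((m.+1 * m.+2)%:R * P m.+1)
    - 2 * 'X * (P m.+1)^`() ^+ 2 - 2 * (P m.+1)^`() * (('X^2 - 1) * Q)).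
    by rewrite /Q polyC1; ring.
  by rewrite -legendre_ode /Q; ring.
have VxE y : V.[y] = e * (P m.+1).[y] ^+ 2 + (1 - y ^+ 2) * (P m.+1)^`().[y] ^+ 2.
  by rewrite /V hornerD !hornerM hornerC hornerD hornerN hornerXn hornerC; ring.
have [c /andP[tc c1] MV] := poly_MVT V t1.
have : 0 <= V.[1] - V.[t].
  rewrite MV VE mulr_ge0 ?subr_ge0 // [_.[c]]hornerM horner_exp hornerM hornerX.
  rewrite mulr_ge0 ?sqr_ge0 // mulr_ge0 ?(le_trans t0 tc) //.
  by rewrite -polyC_natr hornerC ler0n.
rewrite !VxE legendre1 expr1n subrr mul0r addr0 mulr1 subr_ge0 => h.
rewrite -(@expr_le1 _ 2) // -normrX.
rewrite ger0_norm ?sqr_ge0 // -(ler_pM2l e0) mulr1.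
apply: le_trans h; rewrite lerDl mulr_ge0 ?sqr_ge0 // subr_ge0.
by rewrite expr_le1.
Qed.

Lemma legendre_le1 m (t : R) : `|t| <= 1 -> `|(P m).[t]| <= 1.
Proof.
rewrite ler_norml => /andP[tN1 t1]; have [t0|/ltW t0] := leP 0 t.
  by rewrite legendre_le1_ge0 ?t0.
rewrite -[t]opprK horner_legendreN normrM normrX normrN1 expr1n mul1r.
by rewrite legendre_le1_ge0 // oppr_ge0 t0 lerNl.
Qed.
End LegendreBound.

(** * Expansions in even Legendre polynomials and multiplication by [t^2] *)

Section EvenExpansion.
Variable R : realFieldType.
Local Notation P := (legendre R).

Lemma legendre_rec_horner m (t : R) :
  (2 * m.+1).+1%:R * (t * (P m.+1).[t]) = m.+2%:R * (P m.+2).[t] + m.+1%:R * (P m).[t].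
Proof.
by have /(congr1 (horner^~ t)) := legendre_rec_mulX R m; rewrite -!polyC_natr !hornerE.
Qed.

Lemma den1_neq0 (n : nat) : 4 * n%:R - 1 != 0 :> R.
Proof. by rewrite subr_eq0 -natrM -[1]/(1%:R) eqr_nat; case: n => // n; rewrite mulnS. Qed.

Lemma den3_neq0 (n : nat) : 4 * n%:R + 3 != 0 :> R.
Proof. by rewrite -natrM -natrD addn3 pnatr_eq0. Qed.

(** The three-term recurrence is applied to [t P_(2n)], then to [t P_(2n+1)] and [t P_(2n-1)]. At
    [n = 0] the last term carries a factor 0, so the value of [n.-1] there is harmless. *)
Lemma legendre_even_rec n (t : R) :
  (4 * n%:R + 1) * (t ^+ 2 * (P (2 * n)).[t])
  = (2 * n%:R + 1) * (2 * n%:R + 2) / (4 * n%:R + 3) * (P (2 * n.+1)).[t]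
    + ((2 * n%:R + 1) ^+ 2 / (4 * n%:R + 3) + (2 * n%:R) ^+ 2 / (4 * n%:R - 1))
      * (P (2 * n)).[t]
    + 2 * n%:R * (2 * n%:R - 1) / (4 * n%:R - 1) * (P (2 * n.-1)).[t].
Proof.
case: n => [|n].
  have := legendre_rec_horner 0 t.
  rewrite muln0 muln1 legendre_0 legendre_1 hornerX hornerC => h.
  have -> : (P 2).[t] = (3 * (t * t) - 1) / 2 by rewrite h; field.
  by field.
rewrite succnK !mulnS !addSn !add0n -[n.+1%:R]natr1.
have h3 := legendre_rec_horner (2 * n).+2 t.
have h2 := legendre_rec_horner (2 * n).+1 t.
have h1 := legendre_rec_horner (2 * n) t.
set a := (P (2 * n)).[t] in h1 *; set p := (P (2 * n).+1).[t] in h1 h2.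
set q := (P (2 * n).+2).[t] in h1 h2 h3 *; set r := (P (2 * n).+3).[t] in h2 h3.
set s := (P (2 * n).+4).[t] in h3 *.
have d7 := den3_neq0 n.+1; have d3 := den3_neq0 n; rewrite -[n.+1%:R]natr1 in d7.
set x : R := n%:R in d7 d3 *.
have E1 : t * p = ((2 * x + 2) * q + (2 * x + 1) * a) / (4 * x + 3).
  apply: (mulfI d3); rewrite [RHS]mulrC divfK //.
  by transitivity ((2 * (2 * n).+1).+1%:R * (t * p)); [|rewrite h1]; rewrite /x; ring.
have E3 : t * r = ((2 * x + 4) * s + (2 * x + 3) * q) / (4 * (x + 1) + 3).
  apply: (mulfI d7); rewrite [RHS]mulrC divfK //.
  by transitivity ((2 * (2 * n).+3).+1%:R * (t * r)); [|rewrite h3]; rewrite /x; ring.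
have -> : (4 * (x + 1) + 1) * (t ^+ 2 * q) = (2 * x + 3) * (t * r) + (2 * x + 2) * (t * p).
  transitivity (t * ((2 * (2 * n).+2).+1%:R * (t * q))); first by rewrite /x; ring.
  by rewrite h2 /x; ring.
have x0 : 0 <= x by exact: ler0n.
by rewrite E1 E3; field; rewrite !gt_eqF //; lra.
Qed.

(* At [n = 0] the junk value [g 0.-1] is multiplied by 0. *)
Definition mulX2_coef (g : nat -> R) (n : nat) : R :=
  2 * n%:R * (2 * n%:R - 1) / (4 * n%:R - 1) * g n.-1
  + ((2 * n%:R + 1) ^+ 2 / (4 * n%:R + 3) + (2 * n%:R) ^+ 2 / (4 * n%:R - 1)) * g n
  + (2 * n%:R + 1) * (2 * n%:R + 2) / (4 * n%:R + 3) * g n.+1.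

(** Multiplication by [t^2] acts on the coefficients as a tridiagonal operator. The boundary term
    collects the two contributions that cross the cut between [N.-1] and [N]. *)
Lemma mulX2_legendre_sum (g : nat -> R) (N : nat) (t : R) :
  t ^+ 2 * \sum_(0 <= n < N) (4 * n%:R + 1) * g n * (P (2 * n)).[t]
  = \sum_(0 <= n < N) mulX2_coef g n * (P (2 * n)).[t]
    + 2 * N%:R * (2 * N%:R - 1) / (4 * N%:R - 1)
      * (g N.-1 * (P (2 * N)).[t] - g N * (P (2 * N.-1)).[t]).
Proof.
elim: N => [|N IHN]; first by rewrite !big_geq // !(mulr0, mul0r) addr0.
rewrite !big_nat_recr //= mulrDr IHN.
have -> : t ^+ 2 * ((4 * N%:R + 1) * g N * (P (2 * N)).[t])
    = g N * ((4 * N%:R + 1) * (t ^+ 2 * (P (2 * N)).[t])) by ring.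
rewrite legendre_even_rec /mulX2_coef -[N.+1%:R]natr1.
have d7 := den3_neq0 N; have d3 := den1_neq0 N.
by field; rewrite d3 (_ : 4 * (N%:R + 1) - 1 = 4 * N%:R + 3) ?d7 //; ring.
Qed.

(* [(4n+1) * monomial_coef n j] is the coefficient of [P_(2n)] in [X^(2j)]; the
   factor [j - n'] makes it vanish for [n > j]. *)
Fixpoint monomial_coef (n j : nat) : R :=
  if n is n'.+1
  then monomial_coef n' j * (2 * (j%:R - n'%:R)) / (2 * j%:R + 2 * n'%:R + 3)
  else (2 * j%:R + 1)^-1.

Local Notation d := monomial_coef.

Lemma monomial_coef_eq0 n j : (j < n)%N -> d n j = 0.
Proof.
elim: n => // n IHn; rewrite ltnS leq_eqVlt => /orP[/eqP ->|/IHn h] /=.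
  by rewrite subrr mulr0 mulr0 mul0r.
by rewrite h !mul0r.
Qed.

Lemma monomial_coef_den n j : 0 < 2 * j%:R + 2 * n%:R + 3 :> R.
Proof. by rewrite -!natrM -!natrD ltr0n addn3. Qed.

Lemma monomial_coef_ge0 n j : 0 <= d n j.
Proof.
elim: n => [|n IHn] /=; first by rewrite invr_ge0 -natrM natr1.
have [nj|jn] := leqP n j; last by rewrite monomial_coef_eq0 // !mul0r.
by rewrite !mulr_ge0 // ?subr_ge0 ?ler_nat // invr_ge0 ltW ?monomial_coef_den.
Qed.

Lemma monomial_coef_le n j : d n j <= (2 * j%:R + 1)^-1.
Proof.
elim: n => [|n IHn] //=; apply: le_trans IHn.
rewrite -mulrA ler_piMr ?monomial_coef_ge0 // ler_pdivrMr ?monomial_coef_den //.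
by have := ler0n R n; lra.
Qed.

(** This diagonal step reaches column [j.+1] from column [j] without dividing by a factor that may
    vanish, such as [j + 1 - n]. *)
Lemma monomial_coefSS n j :
  d n.+1 j.+1 = d n j * ((2 * j%:R + 1) * (2 * j%:R + 2)
    / ((2 * j%:R + 2 * n%:R + 3) * (2 * j%:R + 2 * n%:R + 5))).
Proof.
have j0 := ler0n R j.
elim: n => [|n IHn].
  by rewrite /= -[j.+1%:R]natr1; field; rewrite !gt_eqF //; lra.
rewrite [LHS]/= -/(d n.+1 j.+1) IHn [d n.+1 j]/= -[j.+1%:R]natr1 -[n.+1%:R]natr1.
by have n0 := ler0n R n; field; rewrite !gt_eqF //; lra.
Qed.

(** Coefficient form of [t^2 * t^(2j) = t^(2(j+1))]. *)
Lemma mulX2_coef_monomial n j :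
  mulX2_coef (fun i => d i j) n = (4 * n%:R + 1) * d n j.+1.
Proof.
have j0 := ler0n R j.
case: n => [|n]; rewrite /mulX2_coef.
  by rewrite /= -[j.+1%:R]natr1; field; rewrite !gt_eqF //; lra.
rewrite succnK monomial_coefSS /= -[n.+1%:R]natr1.
by have n0 := ler0n R n; field; rewrite !gt_eqF //; lra.
Qed.

Lemma monomial_legendre_sum j N (t : R) : (j < N)%N ->
  \sum_(0 <= n < N) (4 * n%:R + 1) * d n j * (P (2 * n)).[t] = t ^+ (2 * j).
Proof.
elim: j N => [|j IHj] N jN.
  rewrite -(prednK jN) big_nat_recl // big1_seq => [|i _].
    by rewrite addr0 /= muln0 legendre_0 hornerC; field.
  by rewrite monomial_coef_eq0 // mulr0 mul0r.
rewrite mulnS exprD -(IHj _ (ltnW jN)) mulX2_legendre_sum.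
(* Since [j.+1 < N], both [N] and [N.-1] exceed [j], so the boundary term is zero. *)
rewrite !monomial_coef_eq0 ?(ltnW jN) //; last by rewrite -ltnS (ltn_predK jN).
rewrite !mul0r subrr mulr0 addr0.
by apply: eq_bigr => n _; rewrite mulX2_coef_monomial.
Qed.

(** All terms are nonnegative, so the sum may be lengthened until the expansion of [t^(2j)] is
    complete; at [t = 1], where every [P_(2n)] is 1, that expansion has value 1. *)
Lemma monomial_coef_sum_le1 j N : \sum_(0 <= n < N) (4 * n%:R + 1) * d n j <= 1.
Proof.
pose F n := (4 * n%:R + 1) * d n j.
have F0 n : 0 <= F n by rewrite mulr_ge0 ?monomial_coef_ge0 // -natrM natr1.
apply: (@le_trans _ _ (\sum_(0 <= n < N + j.+1) F n)).
  by rewrite [leRHS](big_cat_nat (n := N)) ?leq_addr //= lerDl sumr_ge0.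
have := @monomial_legendre_sum j (N + j.+1) 1 (ltn_addl _ (ltnSn j)).
rewrite expr1n => <-; apply: ler_sum => n _.
by rewrite legendre1 mulr1.
Qed.
End EvenExpansion.

(** * The binomial series of [sqrt (1 - y)] and the quarter-disc area *)

Section SqrtSeries.
Variable R : realType.

(** These are the Taylor coefficients of [(1 - y)^(-1/2)]. *)
Definition central_ratio (n : nat) : R := 1 / 4 ^+ n * 'C(2 * n, n)%:R.
Local Notation w := central_ratio.

Lemma central_ratio0 : w 0 = 1.
Proof. by rewrite /w expr0 muln0 bin0; field. Qed.

Lemma bin_central_rec n :
  (n.+1 * 'C(2 * n.+1, n.+1) = 2 * (2 * n).+1 * 'C(2 * n, n))%N.
Proof.
have h1 := mul_bin_diag (2 * n).+2 n; have h2 := mul_bin_down (2 * n).+1 n.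
have e : ((2 * n).+1 - n = n.+1)%N by rewrite mul2n -addnn -addnS addKn.
rewrite e /= in h2; rewrite mulnS add2n -h1 /= -mulnA h2.
by rewrite -[(2 * n).+2]/(2 + 2 * n)%N -mulnS mulnA.
Qed.

Lemma central_ratioS n : w n.+1 = w n * (2 * n%:R + 1) / (2 * n%:R + 2).
Proof.
have n0 := ler0n R n.
have := congr1 (fun k => k%:R : R) (bin_central_rec n).
rewrite !natrM -[n.+1%:R]natr1 -[(2 * n).+1%:R]natr1 natrM => h.
rewrite /w exprS; apply: (@mulfI _ (n%:R + 1)); first by rewrite gt_eqF //; lra.
have -> : (n%:R + 1) * (1 / (4 * 4 ^+ n) * 'C(2 * n.+1, n.+1)%:R)
   = 1 / (4 * 4 ^+ n) * ((n%:R + 1) * 'C(2 * n.+1, n.+1)%:R) :> R by ring.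
have p0 : 4 ^+ n != 0 :> R by rewrite expf_neq0.
by rewrite h; field; rewrite p0 gt_eqF //; lra.
Qed.

Lemma central_ratio_gt0 n : 0 < w n.
Proof. by rewrite /w mulr_gt0 ?divr_gt0 ?exprn_gt0 // ltr0n bin_gt0 leq_pmull. Qed.

Lemma central_ratio_ge0 n : 0 <= w n.
Proof. exact/ltW/central_ratio_gt0. Qed.

(** The left side is nonincreasing in [n], because [(2n+1)(2n+3) <= (2n+2)^2]. This Wallis-type
    bound gives the decay of [w n]. *)
Lemma central_ratio_sqr_le n : w n ^+ 2 * (2 * n%:R + 1) <= 1.
Proof.
elim: n => [|n IHn]; first by rewrite central_ratio0 expr1n mulr0 add0r mulr1.
have n0 := ler0n R n; apply: le_trans IHn.
rewrite central_ratioS -[n.+1%:R]natr1.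
have -> : (w n * (2 * n%:R + 1) / (2 * n%:R + 2)) ^+ 2 * (2 * (n%:R + 1) + 1)
   = w n ^+ 2 * (2 * n%:R + 1) * ((2 * n%:R + 1) * (2 * n%:R + 3) / (2 * n%:R + 2) ^+ 2).
  by field; rewrite gt_eqF //; lra.
rewrite ler_piMr //; first by rewrite mulr_ge0 ?sqr_ge0 //; lra.
by rewrite ler_pdivrMr ?exprn_gt0 //; nra.
Qed.

Lemma central_ratio_le1 n : w n <= 1.
Proof.
rewrite -(@expr_le1 _ 2) ?central_ratio_ge0 //.
apply: le_trans (central_ratio_sqr_le n).
by rewrite ler_peMr ?sqr_ge0 //; have := ler0n R n; lra.
Qed.

Lemma cvg_central_ratio : w n @[n --> \oo] --> 0.
Proof.
apply/cvgrPdist_le => e e0; near=> n.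
rewrite sub0r normrN gtr0_norm ?central_ratio_gt0 //.
rewrite -(@ler_pXn2r _ 2) ?nnegrE ?central_ratio_ge0 ?(ltW e0) //.
have h : (e ^+ 2)^-1 <= n%:R by near: n; exact: nbhs_infty_ger.
have n0 := ler0n R n; have d0 : 0 < 2 * n%:R + 1 :> R by lra.
rewrite -(ler_pM2r d0); apply: le_trans (central_ratio_sqr_le n) _.
by rewrite -[leLHS](@divff _ (e ^+ 2)) ?gt_eqF ?exprn_gt0 // ler_pM2l ?exprn_gt0 //; lra.
Unshelve. all: by end_near. Qed.

Definition sqrt_coef (j : nat) : R := w j / (1 - 2 * j%:R).
Local Notation b := sqrt_coef.

Lemma sqrt_coef0 : b 0 = 1.
Proof. by rewrite /b central_ratio0 mulr0 subr0 divr1. Qed.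

Lemma one_sub_odd_neq0 (j : nat) : 1 - 2 * j%:R != 0 :> R.
Proof.
rewrite subr_eq0 -natrM -[1]/(1%:R) eqr_nat; case: j => // j.
by rewrite mulnS.
Qed.

(** Coefficient form of [sqrt (1 - y) = (1 - y) (1 - y)^(-1/2)]; it makes the sums of [b j] and of
    [|b j|] telescope. *)
Lemma sqrt_coefSE j : b j.+1 = w j.+1 - w j.
Proof.
have j0 := ler0n R j; rewrite /b central_ratioS -[j.+1%:R]natr1; field.
by rewrite gt_eqF ?lt_eqF //; lra.
Qed.

Lemma sqrt_coefS j : (j%:R + 1) * b j.+1 = (j%:R - 1 / 2) * b j.
Proof.
have j0 := ler0n R j; rewrite /b central_ratioS -[j.+1%:R]natr1; field.
by rewrite one_sub_odd_neq0 lt_eqF ?gt_eqF //; lra.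
Qed.

Lemma sqrt_coefS_le0 j : b j.+1 <= 0.
Proof.
have j0 := ler0n R j; rewrite sqrt_coefSE central_ratioS subr_le0 -mulrA.
by rewrite ler_piMr ?central_ratio_ge0 // ler_pdivrMr; lra.
Qed.

Lemma sqrt_coef_sum J : \sum_(0 <= j < J.+1) b j = w J.
Proof.
elim: J => [|J IHJ]; first by rewrite big_nat1 sqrt_coef0 central_ratio0.
by rewrite big_nat_recr //= IHJ sqrt_coefSE addrC subrK.
Qed.

Lemma sqrt_coef_tail J N : (J <= N)%N ->
  \sum_(J.+1 <= j < N.+1) `|b j| = w J - w N.
Proof.
move=> /subnK <-; elim: (N - J)%N => [|k IHk].
  by rewrite add0n big_geq // subrr.
rewrite addSn big_nat_recr /= ?ltnS ?leq_addl // IHk.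
by rewrite ler0_norm ?sqrt_coefS_le0 // sqrt_coefSE; ring.
Qed.

Lemma sqrt_coef_bound j : j.+1%:R * `|b j.+1| <= w j.+1.
Proof.
have j0 := ler0n R j; have w0 := central_ratio_ge0 j.+1.
rewrite /b normrM normfV (ger0_norm w0) ltr0_norm; last first.
  by rewrite -[j.+1%:R]natr1; lra.
rewrite -[X in X * _]natr1 -[in X in _ / X]natr1.
rewrite mulrCA ler_piMr // ler_pdivrMr; lra.
Qed.

Definition sqrt_poly (J : nat) : {poly R} := \sum_(0 <= j < J) b j *: 'X^j.
Local Notation S := sqrt_poly.

Lemma horner_sqrt_poly J (y : R) : (S J).[y] = \sum_(0 <= j < J) b j * y ^+ j.
Proof. by rewrite /S horner_sum; apply: eq_bigr => j _; rewrite !hornerE. Qed.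

(** The function [sqrt (1 - y)] solves [(1 - y) f' + f / 2 = 0]; for its truncated series, the
    coefficient recurrence cancels everything except one top-degree term. *)
Lemma sqrt_poly_ode J (y : R) :
  (1 - y) * (S J.+1)^`().[y] + (S J.+1).[y] / 2 = - (J.+1%:R * b J.+1 * y ^+ J).
Proof.
have SS K : S K.+1 = S K + b K *: 'X^K by rewrite /S big_nat_recr.
elim: J => [|J IHJ].
  rewrite SS /S big_geq // add0r sqrt_coef0 scale1r derivXn mulr0n !hornerE.
  by have := sqrt_coefS 0; rewrite sqrt_coef0; lra.
rewrite SS derivD derivZ derivXn succnK hornerD !hornerZ hornerMn hornerXn hornerD
  hornerZ hornerXn.
have := sqrt_coefS J.+1; move: IHJ.
rewrite -[J.+2%:R]natr1 => h1 ->.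
rewrite -mulr_natl.
move: h1; set u := _^`().[y]; set v := _.[y]; set c := b _; rewrite exprS.
set x := y ^+ J; set m := J.+1%:R => h1.
transitivity ((1 - y) * u + v / 2 + (1 - y) * (c * (m * x)) + c * (y * x) / 2).
  by ring.
by rewrite h1; field.
Qed.

(** If [S] were exactly the square root, [f y = S (1 - y^2) / y] would be constantly 1. It equals 1
    at [y = 1], and its derivative is the residual of the differential equation up to a factor, so
    the mean value theorem on [[z, 1]] bounds the error. *)
Lemma sqrt_poly_error J (z : R) : 0 < z <= 1 ->
  0 <= z * ((S J.+1).[1 - z ^+ 2] - z) <= 2 * w J.+1.
Proof.
move=> /andP[z0 z1].
pose q := S J.+1 \Po (1 - 'X^2).
pose f := horner q * (fun y : R => y^-1).
pose df (y : R) := 2 * (J.+1%:R * b J.+1 * (1 - y ^+ 2) ^+ J) / y ^+ 2.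
have qE y : q.[y] = (S J.+1).[1 - y ^+ 2] by rewrite horner_comp !hornerE.
have dq y : q^`().[y] = - (2 * y * (S J.+1)^`().[1 - y ^+ 2]).
  rewrite deriv_comp derivB derivXn -polyC1 derivC hornerM horner_comp !hornerE.
  by ring.
have fdrv (y : R) : 0 < y -> is_derive y 1 f (df y).
  move=> y0; have yn0 : y != 0 by rewrite gt_eqF.
  have hV : is_derive y 1 (fun y : R => y^-1) (- y ^- 2 *: 1).
    exact: (is_deriveV (f := id)).
  apply: is_derive_eq.
  rewrite dq qE; have := sqrt_poly_ode J (1 - y ^+ 2).
  rewrite /df /GRing.scale /=.
  set u := _^`().[_]; set v := _.[_] => h.
  by rewrite -[J.+1%:R * _ * _]opprK -h; field.
have [y||c] := @MVT_segment R f df z 1 z1.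
- by rewrite in_itv /= => /andP[zy _]; apply: fdrv; exact: lt_trans zy.
- apply: derivable_within_continuous => y; rewrite in_itv /= => /andP[zy _].
  by have [] := fdrv y (lt_le_trans z0 zy).
rewrite in_itv /= => /andP[zc c1].
have c0 : 0 < c by exact: lt_le_trans zc.
have -> : f 1 = 1.
  rewrite /f fctE qE expr1n subrr invr1 mulr1 horner_sqrt_poly big_nat_recl //.
  by rewrite big1 => [|i _]; rewrite ?expr0n ?mulr0 // sqrt_coef0 mulr1 addr0.
rewrite /f fctE qE /df.
set T := (S _).[_]; set E := J.+1%:R * _ * _.
have [E0 Ew] : 0 <= - E /\ - E <= w J.+1.
  have c2 : 0 <= 1 - c ^+ 2 <= 1.
    by rewrite subr_ge0 expr_le1 ?(ltW c0) // c1 lerBlDr lerDl sqr_ge0.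
  have /andP[c20 c21] := c2.
  have B0 : 0 <= J.+1%:R * - b J.+1 by rewrite mulr_ge0 // oppr_ge0 sqrt_coefS_le0.
  have -> : - E = J.+1%:R * - b J.+1 * (1 - c ^+ 2) ^+ J by rewrite /E; ring.
  split; first by rewrite mulr_ge0 // exprn_ge0.
  apply: le_trans (sqrt_coef_bound J); rewrite ler0_norm ?sqrt_coefS_le0 //.
  by rewrite ler_piMr // exprn_ile1.
move=> h.
(* The factor [z] in the statement supplies the [z^2] that absorbs [1 / c^2], as [z <= c]; the bound
   is thus uniform in [z]. *)
have {h} -> : z * (T - z) = 2 * (- E * ((1 - z) * (z / c) ^+ 2)).
  have -> : T = z * (1 - (1 - T * z^-1)) by field; rewrite gt_eqF.
  by rewrite h; field; rewrite gt_eqF.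
have zc0 : 0 <= z / c by rewrite divr_ge0 ?ltW.
have zc1 : z / c <= 1 by rewrite ler_pdivrMr // mul1r.
have r0 : 0 <= (1 - z) * (z / c) ^+ 2 by rewrite mulr_ge0 ?sqr_ge0 ?subr_ge0.
set r := (1 - z) * _ in r0 *.
apply/andP; split; first by rewrite mulr_ge0 // mulr_ge0.
rewrite ler_pM2l //; apply: le_trans Ew; rewrite ler_piMr // /r.
rewrite mulr_ile1 ?sqr_ge0 ?subr_ge0 ?exprn_ile1 //.
by rewrite lerBlDr lerDl ltW.
Qed.

Lemma sqrt_series (y : R) : 0 <= y <= 1 ->
  (S J).[y] @[J --> \oo] --> Num.sqrt (1 - y).
Proof.
move=> /andP[y0 y1]; rewrite -cvg_shiftS.
have := y1; rewrite le_eqVlt => /orP[/eqP ->|{}y1].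
  (* At [y = 1] the error estimate, which requires [z > 0], does not apply; the partial sums there
     are exactly [w J]. *)
  rewrite subrr sqrtr0; under eq_fun do rewrite horner_sqrt_poly.
  rewrite (_ : (fun _ => _) = w); first exact: cvg_central_ratio.
  apply/funext => J; rewrite -sqrt_coef_sum; apply: eq_bigr => j _.
  by rewrite expr1n mulr1.
set z := Num.sqrt _.
have z0 : 0 < z by rewrite sqrtr_gt0 subr_gt0.
have z2 : z ^+ 2 = 1 - y by rewrite sqr_sqrtr // subr_ge0 ltW.
have z1 : z <= 1 by rewrite -(@expr_le1 _ 2) ?(ltW z0) // z2 lerBlDr lerDl.
have E J := @sqrt_poly_error J z (introT andP (conj z0 z1)).
have yE : 1 - z ^+ 2 = y by rewrite z2; ring.
rewrite yE in E.
apply: (@squeeze_cvgr _ _ _ _ (fun=> z) (fun J => z + 2 / z * w J.+1)).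
- near=> J; have /andP[] := E J.
  rewrite pmulr_rge0 // subr_ge0 => -> /=.
  by rewrite mulrC -ler_pdivlMr // lerBlDl mulrAC.
- exact: cvg_cst.
- rewrite -[X in _ --> X]addr0 -(mulr0 (2 / z)).
  apply: cvgD; first exact: cvg_cst.
  apply: cvgMr; rewrite (cvg_shiftS w); exact: cvg_central_ratio.
Unshelve. all: by end_near. Qed.

(** [F J] is the antiderivative of [S (t^2)]. Under [t = sin x] its difference from
    [(sin x cos x + x) / 2], the antiderivative of [cos^2], has as derivative the quantity bounded
    in [sqrt_poly_error] at [z = cos x]. The mean value theorem on [[0, pi / 2]] concludes. *)
Lemma quarter_circle :
  \sum_(0 <= j < J) b j / (2 * j%:R + 1) @[J --> \oo] --> pi / 4.
Proof.
pose F J : {poly R} := \sum_(0 <= j < J) (b j / (2 * j%:R + 1)) *: 'X^((2 * j).+1).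
have dF J x : (F J)^`().[x] = (S J).[x ^+ 2].
  rewrite /F horner_sqrt_poly (big_morph _ (@derivD R) (deriv0 R)) horner_sum.
  apply: eq_bigr => j _.
  rewrite derivZ derivXn succnK hornerZ hornerMn hornerXn exprM.
  by have j0 := ler0n R j; field; rewrite gt_eqF //; lra.
have F0 J : (F J).[0] = 0.
  by rewrite /F horner_sum big1 // => j _; rewrite hornerZ hornerXn expr0n mulr0.
have F1 J : (F J).[1] = \sum_(0 <= j < J) b j / (2 * j%:R + 1).
  by rewrite /F horner_sum; apply: eq_bigr => j _; rewrite hornerZ hornerXn expr1n mulr1.
rewrite (_ : (fun J => _) = (fun J => (F J).[1])); last by apply/funext => J; rewrite F1.
rewrite -cvg_shiftS.
have p0 : 0 <= pi / 2 :> R by rewrite divr_ge0 ?pi_ge0.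
have K J : `|(F J.+1).[1] - pi / 4| <= pi * w J.+1.
  pose f := (horner (F J.+1) \o sin) - (fun x : R => 2^-1 *: (sin x * cos x + x)).
  pose df (x : R) := cos x * ((S J.+1).[1 - cos x ^+ 2] - cos x).
  have fdrv (x : R) : is_derive x 1 f (df x).
    apply: is_derive_eq.
    rewrite dF /df /GRing.scale /= -sin2cos2.
    by have := cos2Dsin2 x; lra.
  have [|c] := @MVT_segment R f df 0 (pi / 2) p0.
    by apply: derivable_within_continuous => x _; have [] := fdrv x.
  rewrite in_itv /= => /andP[c0 cp].
  have -> : f (pi / 2) = (F J.+1).[1] - pi / 4.
    by rewrite /f !fctE /= sin_pihalf cos_pihalf /GRing.scale /=; congr (_ - _); field.
  have -> : f 0 = 0 by rewrite /f !fctE /= sin0 F0 mul0r addr0 scaler0 subr0.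
  rewrite !subr0 => ->.
  have cos_ge0 : 0 <= cos c.
    by rewrite cos_ge0_pihalf // cp andbT (le_trans _ c0) // oppr_le0.
  have /andP[df0 df1] : 0 <= df c <= 2 * w J.+1.
    have [cos0|cos0] := eqVneq (cos c) 0.
      by rewrite /df cos0 mul0r lexx mulr_ge0 ?central_ratio_ge0.
    by apply: sqrt_poly_error; rewrite lt_neqAle eq_sym cos0 cos_ge0 cos_le1.
  rewrite ger0_norm; last exact: mulr_ge0.
  have -> : pi * w J.+1 = 2 * w J.+1 * (pi / 2) by field.
  by rewrite ler_wpM2r.
apply/cvgrPdist_le => e e0.
have pw : pi * w J.+1 @[J --> \oo] --> 0.
  by rewrite -(mulr0 pi); apply: cvgMr; rewrite (cvg_shiftS w); exact: cvg_central_ratio.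
move/cvgrPdist_le : pw => /(_ _ e0); apply: filterS => J.
rewrite sub0r normrN [X in X <= _]ger0_norm ?mulr_ge0 ?pi_ge0 ?central_ratio_ge0 // => h.
by rewrite distrC; exact: le_trans (K J) h.
Qed.
End SqrtSeries.

(** * The Legendre series of [sqrt (1 - t^2)], the case [k = 1] *)

Section SqrtLegendre.
Variable R : realType.
Local Notation P := (legendre R).
Local Notation w := (central_ratio R).
Local Notation b := (sqrt_coef R).
Local Notation d := (monomial_coef R).

(** Kept free of division, so that it also covers [n = j + 1], where the left factor vanishes. *)
Lemma monomial_coef_recr n j :
  (j%:R + 1 - n%:R) * (2 * j%:R + 2 * n%:R + 3) * d n j.+1
  = (j%:R + 1) * (2 * j%:R + 1) * d n j.
Proof.
have j0 := ler0n R j; case: n => [|n].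
  by rewrite /= -[j.+1%:R]natr1; field; rewrite !gt_eqF //; lra.
rewrite monomial_coefSS [d n.+1 j]/= -[n.+1%:R]natr1.
by have n0 := ler0n R n; field; rewrite !gt_eqF //; lra.
Qed.

(* Zeilberger certificate: the summand is the difference in [j] of
   [- (8n+6) (j-n) b_j d_(n,j)]. *)
Lemma sqrt_legendre_coef_telescope n J :
  4 * (n%:R + 1) * (n%:R + 2) * (\sum_(0 <= j < J) b j * d n.+1 j)
  - (2 * n%:R + 1) * (2 * n%:R - 1) * (\sum_(0 <= j < J) b j * d n j)
  = - ((8 * n%:R + 6) * ((J%:R - n%:R) * (b J * d n J))).
Proof.
have n0 := ler0n R n; elim: J => [|J IHJ].
  rewrite !big_geq // !mulr0 subr0; case: n {n0} => [|n].
    by rewrite subr0 mul0r mulr0 oppr0.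
  by rewrite monomial_coef_eq0 // !mulr0 oppr0.
set p := 4 * _ * _ in IHJ *; set q := (_ + 1) * _ in IHJ *.
rewrite !big_nat_recr // (mulrDr p) (mulrDr q) opprD addrACA IHJ.
have J0 := ler0n R J; have e0 : 2 * J%:R + 2 * n%:R + 3 != 0 :> R.
  by rewrite gt_eqF //; lra.
have -> : (J.+1%:R - n%:R) * (b J.+1 * d n J.+1)
    = (J%:R - 1 / 2) * b J * ((2 * J%:R + 1) * d n J) / (2 * J%:R + 2 * n%:R + 3).
  rewrite -sqrt_coefS; apply: (mulIf e0); rewrite divfK //.
  transitivity (b J.+1 * ((J%:R + 1 - n%:R) * (2 * J%:R + 2 * n%:R + 3) * d n J.+1)).
    by rewrite -[J.+1%:R]natr1; ring.
  by rewrite monomial_coef_recr; ring.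
rewrite [d n.+1 J]/=; set bJ := b J; set dJ := d n J.
by rewrite /p /q; field.
Qed.

Lemma norm_sqrt_coef_le j : `|b j| <= w j.
Proof.
case: j => [|j]; first by rewrite sqrt_coef0 central_ratio0 normr1.
by apply: le_trans (sqrt_coef_bound R j); rewrite ler_peMl // ler1n.
Qed.

(** For [n <= J], [(J - n) d n J <= (J - n) / (2J + 1) <= 1]; hence the telescoped remainder tends
    to 0. *)
Lemma sqrt_legendre_coef_rest n J :
  `|(8 * n%:R + 6) * ((J%:R - n%:R) * (b J * d n J))| <= (8 * n%:R + 6) * w J.
Proof.
have n0 := ler0n R n; have J0 := ler0n R J.
have e0 : 0 <= 8 * n%:R + 6 :> R by lra.
rewrite normrM ger0_norm // ler_wpM2l //.
have [nJ|Jn] := leqP n J; last first.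
  by rewrite monomial_coef_eq0 // !mulr0 normr0 central_ratio_ge0.
have nJ' : n%:R <= J%:R :> R by rewrite ler_nat.
rewrite mulrCA normrM (le_trans _ (norm_sqrt_coef_le J)) // ler_piMr //.
rewrite ger0_norm ?mulr_ge0 ?subr_ge0 ?monomial_coef_ge0 //.
apply: (@le_trans _ _ ((J%:R - n%:R) * (2 * J%:R + 1)^-1)).
  by rewrite ler_wpM2l ?subr_ge0 ?monomial_coef_le.
by rewrite ler_pdivrMr; lra.
Qed.

(** Closed form of the integral of [sqrt (1 - t^2) P_(2n)(t)] over [[0, 1]]. *)
Definition half_circle_coef (n : nat) : R :=
  pi / 4 * (w n ^+ 2 / ((n%:R + 1) * (1 - 2 * n%:R))).

Lemma cvg_half_circle_coef n :
  \sum_(0 <= j < J) b j * d n j @[J --> \oo]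
    --> half_circle_coef n.
Proof.
elim: n => [|n IHn].
  rewrite /half_circle_coef central_ratio0 expr1n mulr0 subr0 add0r !mulr1 invr1 !mulr1.
  exact: quarter_circle.
have n0 := ler0n R n; pose D : R := 4 * (n%:R + 1) * (n%:R + 2).
have D0 : D != 0 by rewrite gt_eqF // /D !mulr_gt0 //; lra.
pose V k J := \sum_(0 <= j < J) b j * d k j.
pose G J := (8 * n%:R + 6) * ((J%:R - n%:R) * (b J * d n J)).
(* The telescoped identity solved for the partial sum at [n.+1]; [G] vanishes in the limit, leaving
   the first-order recurrence that the closed form satisfies. *)
have VE J : V n.+1 J = D^-1 * ((2 * n%:R + 1) * (2 * n%:R - 1) * V n J - G J).
  by apply: (mulfI D0); rewrite mulVKf // -[- G J]sqrt_legendre_coef_telescope /V /D; ring.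
rewrite (_ : (fun J => _) = V n.+1) //; rewrite (funext VE).
have G0 : G J @[J --> \oo] --> 0.
  apply/norm_cvg0P; apply: (@squeeze_cvgr _ _ _ _ (fun=> 0) (fun J => (8 * n%:R + 6) * w J)).
  - by near=> J; rewrite normr_ge0 sqrt_legendre_coef_rest.
  - exact: cvg_cst.
  - rewrite -[X in _ --> X](mulr0 (8 * n%:R + 6)).
    by apply: cvgMr; exact: cvg_central_ratio.
rewrite (_ : half_circle_coef n.+1
   = D^-1 * ((2 * n%:R + 1) * (2 * n%:R - 1) * half_circle_coef n - 0)).
  by apply: cvgMr; apply: cvgB => //; apply: cvgMr.
rewrite /half_circle_coef central_ratioS -[n.+1%:R]natr1 /D; field.
rewrite one_sub_odd_neq0 /=; apply/and4P.
by split; [rewrite gt_eqF|rewrite gt_eqF|rewrite lt_eqF|rewrite gt_eqF]; lra.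
Unshelve. all: by end_near. Qed.

Lemma sqrt_legendre_series (t : R) : `|t| <= 1 ->
  \sum_(0 <= n < N) (4 * n%:R + 1) * half_circle_coef n * (P (2 * n)).[t]
     @[N --> \oo] --> Num.sqrt (1 - t ^+ 2).
Proof.
move=> t1.
pose T j N := \sum_(0 <= n < N) (4 * n%:R + 1) * d n j * (P (2 * n)).[t].
have T1 j N : `|T j N| <= 1.
  apply: le_trans (monomial_coef_sum_le1 R j N).
  apply: le_trans (ler_norm_sum _ _ _) _; apply: ler_sum => n _.
  have d0 : 0 <= (4 * n%:R + 1) * d n j.
    by rewrite mulr_ge0 ?monomial_coef_ge0 // -natrM natr1.
  by rewrite normrM ger0_norm // ler_piMr // legendre_le1.
pose A N J := \sum_(0 <= j < J) b j * T j N.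
have AE N J : A N J = \sum_(0 <= n < N) (4 * n%:R + 1)
    * (\sum_(0 <= j < J) b j * d n j) * (P (2 * n)).[t].
  rewrite /A /T; under eq_bigr do rewrite mulr_sumr.
  rewrite exchange_big; apply: eq_bigr => n _.
  by rewrite mulr_sumr mulr_suml; apply: eq_bigr => j _; ring.
have Acvg N : A N J @[J --> \oo]
    --> \sum_(0 <= n < N) (4 * n%:R + 1) * half_circle_coef n * (P (2 * n)).[t].
  rewrite (funext (AE N)).
  apply: cvg_big => [|n _]; first exact: add_continuous.
  by apply: cvgMl; apply: cvgMr; exact: cvg_half_circle_coef.
(* Because [|T j N| <= 1], this tail estimate in [J] is uniform in [N], which is what permits the
   exchange of limits. *)
have Atail N J K : (J <= K)%N -> `|A N K.+1 - A N J.+1| <= w J.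
  move=> JK; rewrite /A [X in X - _](big_cat_nat (n := J.+1)) // addrC addKr.
  apply: le_trans (ler_norm_sum _ _ _) _.
  apply: (@le_trans _ _ (w J - w K)); last by rewrite gerBl central_ratio_ge0.
  rewrite -sqrt_coef_tail //; apply: ler_sum => j _.
  by rewrite normrM ler_piMr.
(* On the diagonal every expansion of [t^(2j)] with [j <= J] is complete. *)
have sumE J : A J.+1 J.+1 = (sqrt_poly R J.+1).[t ^+ 2].
  rewrite horner_sqrt_poly /A !big_mkord; apply: eq_bigr => j _.
  by rewrite /T monomial_legendre_sum // exprM.
pose s N := \sum_(0 <= n < N) (4 * n%:R + 1) * half_circle_coef n * (P (2 * n)).[t].
have near_s J : `|s J.+1 - (sqrt_poly R J.+1).[t ^+ 2]| <= w J.
  rewrite -sumE.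
  (* Letting [K] tend to infinity in [Atail] with [N = J.+1] fixed replaces the inner sums by their
     limits. *)
  apply: (@cvgr_to_le _ \oo _ _ (fun K => `|A J.+1 K.+1 - A J.+1 J.+1|)).
    apply: cvg_norm; apply: cvgB; last exact: cvg_cst.
    by rewrite (cvg_shiftS (A J.+1)); exact: Acvg.
  by exists J => // K /=; exact: Atail.
have diff0 : s J.+1 - (sqrt_poly R J.+1).[t ^+ 2] @[J --> \oo] --> 0.
  apply/norm_cvg0P; apply: (@squeeze_cvgr _ _ _ _ (fun=> 0) w).
  - by near=> J; rewrite normr_ge0 near_s.
  - exact: cvg_cst.
  - exact: cvg_central_ratio.
rewrite -[X in X @ _]/s -cvg_shiftS.
rewrite (_ : [sequence s J.+1]_J = (fun J => (s J.+1 - (sqrt_poly R J.+1).[t ^+ 2])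
   + (sqrt_poly R J.+1).[t ^+ 2])); last by apply/funext => J; rewrite subrK.
rewrite -[Num.sqrt _]add0r; apply: cvgD => //.
rewrite (cvg_shiftS (fun J => (sqrt_poly R J).[t ^+ 2])).
by apply: sqrt_series; rewrite sqr_ge0 -real_normK ?num_real // expr_le1.
Unshelve. all: by end_near. Qed.
End SqrtLegendre.

(** * All odd powers, by induction on [r] *)

Section OddPowers.
Variable R : realType.
Local Notation P := (legendre R).
Local Notation w := (central_ratio R).

Lemma pochhammer_recr (a : R) j : pochhammer a j.+1 = pochhammer a j * (a + j%:R).
Proof. by rewrite /pochhammer big_ord_recr. Qed.

(** A half-odd number is at distance at least 1/2 from 0; this keeps the second Pochhammer symbol
    away from zero. *)
Lemma half_odd_norm_ge (n r : nat) : 1 / 2 <= `|1 / 2 - n%:R + r%:R| :> R.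
Proof.
have [nr|rn] := leqP n r.
  have : n%:R <= r%:R :> R by rewrite ler_nat.
  by move=> h; apply: le_trans (ler_norm _); lra.
have : r.+1%:R <= n%:R :> R by rewrite ler_nat.
by rewrite -[r.+1%:R]natr1 -normrN => h; apply: le_trans (ler_norm _); lra.
Qed.

Lemma half_odd_neq0 (n r : nat) : 1 / 2 - n%:R + r%:R != 0 :> R.
Proof. by rewrite -normr_gt0; apply: lt_le_trans (half_odd_norm_ge n r); lra. Qed.

(* The exponent of the theorem is [k = 2r+1]. *)
Definition power_coef (r n : nat) : R :=
  w n ^+ 2 / (pochhammer (n%:R + 1) r.+1 * pochhammer (1 / 2 - n%:R) r.+1).
Local Notation g := power_coef.

Lemma power_coef0 n : g 0 n = w n ^+ 2 / ((n%:R + 1) * (1 / 2 - n%:R)).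
Proof. by rewrite /g /pochhammer !big_ord1 !addr0. Qed.

Lemma power_coefS r n :
  g r.+1 n = g r n / ((n%:R + 1 + r.+1%:R) * (1 / 2 - n%:R + r.+1%:R)).
Proof. by rewrite /g 2!(pochhammer_recr _ r.+1) mulrACA [in LHS]invfM mulrA. Qed.

Ltac solve_neq0 := repeat (apply/andP; split); try (by rewrite gt_eqF //; lra);
  match goal with h : is_true (_ != 0) |- _ =>
    by apply: contraNneq h => ?; apply/eqP; lra end.

(** With this ratio, neighbouring coefficients are multiples of a single one, and [power_coef_step]
    becomes an identity of rational functions in [n] and [r]. *)
Lemma power_coef_recn r n : g r n.+1
  = - (g r n * ((2 * n%:R + 1) * (1 / 2 - n%:R + r%:R))
       / (2 * (n%:R + 1) * (n%:R + r%:R + 2))).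
Proof.
have n0 := ler0n R n; elim: r => [|r IHr].
  rewrite !power_coef0 central_ratioS -[n.+1%:R]natr1.
  have := half_odd_neq0 n 0; have := half_odd_neq0 n.+1 0.
  rewrite -[n.+1%:R]natr1 !addr0; move: (n%:R) n0 => x x0 h1 h2.
  by field; solve_neq0.
rewrite !power_coefS IHr -[n.+1%:R]natr1 -[r.+1%:R]natr1.
have r0 := ler0n R r; have := half_odd_neq0 n r; have := half_odd_neq0 n r.+1.
rewrite -[r.+1%:R]natr1; have := half_odd_neq0 n.+1 r.+1.
rewrite -[n.+1%:R]natr1 -[r.+1%:R]natr1.
move: (g r n) => u; move: (n%:R) (r%:R) n0 r0 => x y x0 y0 h1 h2 h3.
by field; solve_neq0.
Qed.

(** Coefficient form of multiplication by [1 - t^2]. The constant is 4, from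
    [x (1 - x) = (1 - t^2) / 4], times the ratio [(2r+3)^2 / 16] of successive prefactors. *)
Lemma power_coef_step r n :
  (4 * n%:R + 1) * g r n - mulX2_coef (g r) n
  = (2 * r%:R + 3) ^+ 2 / 4 * ((4 * n%:R + 1) * g r.+1 n).
Proof.
have r0 := ler0n R r; case: n => [|n].
  rewrite /mulX2_coef power_coef_recn power_coefS -[r.+1%:R]natr1.
  by field; solve_neq0.
rewrite /mulX2_coef succnK power_coefS !power_coef_recn -[n.+1%:R]natr1 -[r.+1%:R]natr1.
have n0 := ler0n R n; have := half_odd_neq0 n.+1 r.+1.
rewrite -[n.+1%:R]natr1 -[r.+1%:R]natr1.
move: (g r n) => u; move: (n%:R) (r%:R) n0 r0 => x y x0 y0 h1.
by field; solve_neq0.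
Qed.

(** Each further pair of Pochhammer factors has product at least 1/2 in absolute value, hence costs
    a factor 2. The weight [n + 1] matches the linear growth of the boundary term. *)
Lemma power_coef_bound r n : (n%:R + 1) * `|g r n| <= 2 ^+ r.+1 * w n.
Proof.
have n0 := ler0n R n; have w0 := central_ratio_ge0 R n.
elim: r => [|r IHr].
  have h := half_odd_norm_ge n 0; rewrite addr0 in h.
  have h0 : 0 < `|1 / 2 - n%:R| :> R by apply: lt_le_trans h; lra.
  rewrite power_coef0 normrM (ger0_norm (sqr_ge0 (w n))) normfV normrM expr1.
  rewrite [`|n%:R + 1|]ger0_norm ?addr_ge0 //.
  have -> : (n%:R + 1) * (w n ^+ 2 / ((n%:R + 1) * `|1 / 2 - n%:R|))
    = w n ^+ 2 / `|1 / 2 - n%:R|.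
    by field; rewrite !gt_eqF //; lra.
  rewrite ler_pdivrMr //; have w1 := central_ratio_le1 R n.
  by move: h w0 w1; set u := w n; set v := `|_| => *; nra.
rewrite power_coefS exprS -mulrA [leRHS]mulrC.
move: (g r n) (2 ^+ r.+1) IHr => u c IHr; rewrite normrM mulrA.
apply: ler_pM => //.
rewrite normfV normrM.
have h := half_odd_norm_ge n r.+1.
have h1 : 1 <= `|n%:R + 1 + r.+1%:R| :> R.
  by rewrite ger0_norm ?addr_ge0 //; have := ler0n R r.+1; lra.
have h2 : 1 / 2 <= `|n%:R + 1 + r.+1%:R| * `|1 / 2 - n%:R + r.+1%:R| :> R by nra.
rewrite -[leLHS]div1r ler_pdivrMr; first by lra.
by apply: lt_le_trans h2; lra.
Qed.

(** The rational prefactor is at most [2N] and [|P_m| <= 1], so [power_coef_bound] dominates the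
    boundary term by multiples of [w K] and [w K.+1]. Taking [N = K.+1] makes [N.-1] a genuine
    predecessor. *)
Lemma cvg_shift_remainder r (t : R) : `|t| <= 1 ->
  (let N := K.+1 in 2 * N%:R * (2 * N%:R - 1) / (4 * N%:R - 1)
    * (g r N.-1 * (P (2 * N)).[t] - g r N * (P (2 * N.-1)).[t]))
  @[K --> \oo] --> 0.
Proof.
move=> t1; apply/norm_cvg0P.
apply: (@squeeze_cvgr _ _ _ _ (fun=> 0) (fun K => 2 ^+ r.+2 * (w K + w K.+1))).
- near=> K; rewrite normr_ge0 /=.
  have K0 := ler0n R K; rewrite -[K.+1%:R]natr1.
  set x : R := K%:R in K0 *; set p := (P _).[t]; set q := (P _).[t].
  have p1 : `|p| <= 1 by exact: legendre_le1.
  have q1 : `|q| <= 1 by exact: legendre_le1.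
  have b0 := power_coef_bound r K; have b1 := power_coef_bound r K.+1.
  rewrite -[K.+1%:R]natr1 -/x in b0 b1.
  have f0 : 0 <= (2 * (x + 1) - 1) / (4 * (x + 1) - 1) by rewrite divr_ge0; lra.
  have f1 : (2 * (x + 1) - 1) / (4 * (x + 1) - 1) <= 1 by rewrite ler_pdivrMr; lra.
  have diff_le : `|g r K * p - g r K.+1 * q| <= `|g r K| + `|g r K.+1|.
    apply: le_trans (ler_normB _ _) _.
    by rewrite !normrM lerD // ler_piMr.
  have x1 : 0 <= 2 * (x + 1) by lra.
  rewrite -!(mulrA (2 * (x + 1))) normrM (ger0_norm x1) normrM (ger0_norm f0).
  set u := `|g r K| in b0 diff_le; set v := `|g r K.+1| in b1 diff_le.
  have u0 : 0 <= u by exact: normr_ge0.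
  have v0 : 0 <= v by exact: normr_ge0.
  apply: (@le_trans _ _ (2 * (x + 1) * (u + v))).
    rewrite ler_wpM2l // (le_trans _ diff_le) // ler_piMl //.
  by rewrite [2 ^+ r.+2]exprS -mulrA -[leRHS]mulrA ler_pM2l //; nra.
- exact: cvg_cst.
- rewrite -[X in _ --> X](mulr0 (2 ^+ r.+2)) -[X in _ * X](addr0 0).
  apply: cvgMr; apply: cvgD; first exact: cvg_central_ratio.
  rewrite (cvg_shiftS w); exact: cvg_central_ratio.
Unshelve. all: by end_near. Qed.
Definition power_const (r : nat) : R :=
  pi * (double_fact r.*2.+1)%:R ^+ 2 / 4 ^+ r.*2.+2.

Lemma power_constS r :
  power_const r.+1 = power_const r * ((2 * r%:R + 3) ^+ 2 / 16).
Proof.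
rewrite /power_const doubleS.
rewrite (_ : double_fact r.*2.+3 = (r.*2.+3 * double_fact r.*2.+1)%N) // natrM.
have p0 : 4 ^+ r.*2.+2 != 0 :> R by rewrite expf_neq0.
have -> : 4 ^+ r.*2.+4 = 16 * 4 ^+ r.*2.+2 :> R.
  by rewrite 2!exprS mulrA; congr (_ * _); ring.
have -> : r.*2.+3%:R = 2 * r%:R + 3 :> R by rewrite -addn3 natrD -mul2n natrM.
by field.
Qed.

Lemma power_const_neq0 r : power_const r != 0.
Proof.
elim: r => [|r IHr].
  by rewrite /power_const !mulf_neq0 ?invr_neq0 ?expf_neq0 ?gt_eqF ?pi_gt0.
by rewrite power_constS mulf_neq0 // mulf_neq0 // expf_neq0 // gt_eqF.
Qed.

Lemma power_legendre_series r (t : R) : `|t| <= 1 ->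
  \sum_(0 <= n < N) (4 * n%:R + 1) * g r n * (P (2 * n)).[t] @[N --> \oo]
    --> (Num.sqrt (1 - t ^+ 2) / 2) ^+ r.*2.+1 / power_const r.
Proof.
move=> t1; pose s r N := \sum_(0 <= n < N) (4 * n%:R + 1) * g r n * (P (2 * n)).[t].
have t2 : 0 <= 1 - t ^+ 2 by rewrite subr_ge0 -real_normK ?num_real // expr_le1.
rewrite -[X in X @ _]/(s r); elim: r => [|r IHr].
  (* The factor [8 / pi] undoes the [pi / 4] of [half_circle_coef] and turns [1 - 2n] into
     [1/2 - n]. *)
  have sE N : s 0 N = 8 / pi *
      \sum_(0 <= n < N) (4 * n%:R + 1) * half_circle_coef R n * (P (2 * n)).[t].
    rewrite mulr_sumr; apply: eq_bigr => n _; rewrite power_coef0 /half_circle_coef.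
    have := half_odd_neq0 n 0; rewrite addr0; have := ler0n R n; have := pi_gt0 R.
    move: (n%:R) => y p0 y0 h; field; solve_neq0.
  rewrite (funext sE) (_ : _ / power_const 0 = 8 / pi * Num.sqrt (1 - t ^+ 2)).
    by apply: cvgMr; exact: sqrt_legendre_series.
  rewrite /power_const; set q := Num.sqrt _; have := pi_gt0 R => p0.
  by rewrite double0 /double_fact; move: (@pi R) p0 => p p0; field; rewrite gt_eqF.
pose c : R := (2 * r%:R + 3) ^+ 2 / 4.
have c0 : c != 0 by rewrite mulf_neq0 // expf_neq0 // gt_eqF.
pose rest N := 2 * N%:R * (2 * N%:R - 1) / (4 * N%:R - 1)
    * (g r N.-1 * (P (2 * N)).[t] - g r N * (P (2 * N.-1)).[t]).
(* Partial sums for [r.+1] are those for [r] times [1 - t^2], up to [rest], which tends to 0. *)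
have sE N : s r.+1 N = c^-1 * ((1 - t ^+ 2) * s r N + rest N).
  apply: (mulfI c0); rewrite mulVKf // mulrBl mul1r mulX2_legendre_sum opprD addrA subrK.
  rewrite /s -sumrB mulr_sumr; apply: eq_bigr => n _.
  by rewrite -mulrBl power_coef_step mulrA.
rewrite (funext sE) (_ : _ / power_const r.+1 = c^-1 * ((1 - t ^+ 2)
    * ((Num.sqrt (1 - t ^+ 2) / 2) ^+ r.*2.+1 / power_const r) + 0)).
  apply: cvgMr; apply: cvgD; first exact: cvgMr.
  rewrite -cvg_shiftS; exact: cvg_shift_remainder.
rewrite addr0 power_constS doubleS [_ ^+ r.*2.+3]exprS [_ ^+ r.*2.+2]exprS.
rewrite -[X in c^-1 * (X * _)](sqr_sqrtr t2).
set q := Num.sqrt _; set q' := (q / 2) ^+ _.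
have k0 := power_const_neq0 r; have r0 := ler0n R r.
rewrite /c; move: (power_const r) k0 => k k0.
by field; rewrite k0 gt_eqF //; lra.
Qed.
End OddPowers.

(** * Return to the variable [x] through [t = 2x - 1] *)

Theorem theorem1 (R : realType) (k : nat) (hk : odd k) (x : R)
    (hx : 0 <= x <= 1) :
  let a (n : nat) : R :=
    (4 * n + 1)%:R * (1 / 4 ^+ n * 'C(2 * n, n)%:R) ^+ 2
      / (pochhammer (n%:R + 1) (k.+1 %/ 2) * pochhammer (1 / 2 - n%:R) (k.+1 %/ 2))
      * (legendre R (2 * n)).[2 * x - 1] in
  cvgn (series a) /\
  (x * (1 - x)) `^ (k%:R / 2)
    = pi * (double_fact k)%:R ^+ 2 / 4 ^+ k.+1 * limn (series a).
Proof.
move=> a; have /andP[x0 x1] := hx.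
set r := k./2; have kE : k = r.*2.+1 by rewrite -[k]odd_double_half hk.
have rE : (k.+1 %/ 2 = r.+1)%N by rewrite kE -doubleS -muln2 mulnK.
have t1 : `|2 * x - 1| <= 1 by rewrite ler_norml; apply/andP; split; lra.
have aE n : a n = (4 * n%:R + 1) * power_coef R r n * (legendre R (2 * n)).[2 * x - 1].
  by rewrite /a rE natrD natrM /power_coef [in RHS]mulrA.
have xx0 : 0 <= x * (1 - x) by rewrite mulr_ge0 // subr_ge0.
have sqrtE : Num.sqrt (1 - (2 * x - 1) ^+ 2) / 2 = Num.sqrt (x * (1 - x)).
  rewrite (_ : 1 - _ = 2 ^+ 2 * (x * (1 - x))); last by ring.
  by rewrite sqrtrM // sqrtr_sqr ger0_norm // mulrC mulKf.
have lima : series a @ \oo --> (x * (1 - x)) `^ (k%:R / 2) / power_const R r.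
  (* The real power [k / 2] is rewritten as the natural power [k] of a square root, the form in
     which the limit is known. *)
  rewrite [k%:R / 2]mulrC powRrM powR12_sqrt // powR_mulrn ?sqrtr_ge0 // -sqrtE kE.
  rewrite (_ : series a = fun N => \sum_(0 <= n < N) (4 * n%:R + 1)
    * power_coef R r n * (legendre R (2 * n)).[2 * x - 1]).
    exact: power_legendre_series.
  by apply/funext => N; apply: eq_bigr => n _; rewrite aE.
split; first exact: cvgP lima.
have -> : pi * (double_fact k)%:R ^+ 2 / 4 ^+ k.+1 = power_const R r.
  by rewrite /power_const -kE.
rewrite (cvg_lim _ lima) // [RHS]mulrC divfK //.
exact: power_const_neq0.
Qed.
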